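(* Let $k\in\mathbb{N}$, let $X,Y$ be Banach spaces and let $u:\mathbb{R}_{\ge 0}\to\mathcal{L}(X;Y)$ be a function. Then the following are equivalent: (a) for each $x\in X$ there is $t_x\ge 0$ such that the orbit $u_x$ is $k$-times differentiable on $(t_x,\infty)$; (b) there is $t\ge 0$ such that for all $x\in X$ the orbit $u_x$ is $k$-times differentiable on $(t,\infty)$.
   Context: $\mathbb{N}=\{1,2,3,\dots\}$. $X,Y$ are Banach spaces over the same field $\mathbb{R}$ or $\mathbb{C}$; $\mathcal{L}(X;Y)$ is the space of bounded linear operators from $X$ to $Y$; $\mathbb{R}_{\ge 0}=[0,\infty)$. No continuity or other regularity of $u$ is assumed. For $x\in X$, the orbit is the function $u_x:\mathbb{R}_{\ge 0}\to Y$, $u_x(t)=u(t)x$. Derivatives of orbits are taken in the norm of $Y$, and $k$-times differentiable on an open interval means that the derivatives up to order $k$ exist at every point of the interval. *)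

(* Defs.v *)
From HB Require Import structures.
From mathcomp Require Import all_boot all_order all_algebra.
From mathcomp Require Import all_classical all_reals all_analysis.
From mathcomp Require Import complex.

Set Implicit Arguments.
Unset Strict Implicit.
Unset Printing Implicit Defensive.

Import Order.TTheory GRing.Theory Num.Theory.
Import numFieldNormedType.Exports.

Local Open Scope classical_set_scope.
Local Open Scope ring_scope.

Definition bounded_op (K : numFieldType) (X Y : normedModType K) : Type :=
  {f : {linear X -> Y} | exists M : K, forall x : X, `|f x| <= M * `|x|}.

(* [u] only has values at nonnegative times; [`|t|] extends the orbit evenly
   to a function on the whole line. Below, derivatives are only taken at
   positive times, where the extension plays no role. *)
Definition orbit_fun (R : realType) (K : numFieldType) (X Y : normedModType K)
    (u : {nonneg R} -> bounded_op X Y) (x : X) : R -> Y :=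
  fun t => sval (u (`|t|%:nng)) x.

(* Derivatives of functions of a real variable with values in a normed space
   over [K], where [iota : R -> K] embeds the reals into the scalars: it is the
   identity for [K = R] and the inclusion for [K = R[i]]. The library's
   [derivable] needs the variable to range over a [K]-vector space, which
   excludes [K = R[i]]; the two notions agree for [K = R], see
   [rderivableE] and [rderivenE]. *)
Section RealVariableDerivative.
Context (R : realType) (K : numFieldType) (iota : R -> K) (Y : normedModType K).
Implicit Types (f : R -> Y) (s : R).

Definition diff_quotient f s : R -> Y :=
  fun h => (iota h)^-1 *: (f (h + s) - f s).

Definition rderivable f s : Prop := cvg (diff_quotient f s @ 0^').

Definition rderive f : R -> Y := fun s => lim (diff_quotient f s @ 0^').

Definition rderiven (n : nat) f : R -> Y := iter n rderive f.

Definition times_differentiable_on (k : nat) f (D : set R) : Prop :=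
  forall j : nat, (j < k)%N -> forall s : R, D s -> rderivable (rderiven j f) s.

End RealVariableDerivative.

Lemma rderivableE (R : realType) (Y : normedModType R) (f : R -> Y) (s : R) :
  rderivable idfun f s <-> derivable f s 1.
Proof.
rewrite /rderivable /derivable.
suff -> : diff_quotient idfun f s =
    (fun h : R => h^-1 *: ((f \o shift s) (h *: 1) - f s)) by [].
by apply/funext => h; rewrite /diff_quotient /= [h *: 1]mulr1.
Qed.

Lemma rderivenE (R : realType) (Y : normedModType R) (f : R -> Y) (n : nat) :
  rderiven idfun n f = derive1n n f.
Proof. by []. Qed.

(* Main.v *)
Require Import Defs.
From HB Require Import structures.
From mathcomp Require Import all_boot all_order all_algebra.
From mathcomp Require Import all_classical all_reals all_analysis.
From mathcomp Require Import complex.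
From mathcomp Require Import ring lra.

Set Implicit Arguments.
Unset Strict Implicit.
Unset Printing Implicit Defensive.

Import Order.TTheory GRing.Theory Num.Theory.
Import numFieldNormedType.Exports.

Local Open Scope classical_set_scope.
Local Open Scope ring_scope.

(** Let X and Y be real Banach spaces. At a point s consider the difference
    quotients D_h = (u (h + s) - u s) / h and the subspace W of those x for
    which D_h x converges as h tends to 0. If W is not all of X, then X \ W
    contains a countable intersection of dense open sets ([not_cvg_comeagre]).
    Indeed, either the operators D_h with h small are bounded in norm by one
    constant; then W is closed, and the complement of a closed proper subspace
    is open and dense. Or there is no such constant; then for each neighbourhood
    of 0 and each m the vectors x with |D_h x| > m for some h in that
    neighbourhood form a dense open set, and D_h x is unbounded near 0 for every
    x common to all these sets. That h runs through uncountably many values is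
    harmless, since any union of open sets is open.

    If no threshold works for all x when k = 1, there are points s_n tending to
    infinity at each of which some orbit is not differentiable. The Baire
    category theorem, applied to the dense open sets of all the s_n together,
    gives one x whose orbit is differentiable at none of the s_n, so that x has
    no threshold of its own ([rderivable_uniform]).

    For larger k, beyond the threshold for the first derivative the maps sending
    x to the derivative of its orbit at s are again bounded linear, as
    pointwise limits of bounded operators ([bounded_linear_rderive]), and the
    argument repeats with the derivatives in place of the orbits. The induction
    is therefore over families v x s that are bounded linear in x only for s
    beyond some t0 ([times_differentiable_uniform]).

    A complex Banach space is a real one by restriction of scalars, with the
    same uniform structure, hence the same limits; the difference quotients
    are the same too, so the complex case is the real one for [realify X] and
    [realify Y]. *)

(** * Bounded linear maps *)

Section BoundedLinear.
Context (R : realType) (X Y : normedModType R).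

(** A predicate on bare functions, since derivatives of orbits are linear in x
    only at sufficiently large times. *)
Definition bounded_linear (f : X -> Y) : Prop := linear f /\ continuous f.

Lemma bounded_linearZ f a x : bounded_linear f -> f (a *: x) = a *: f x.
Proof.
move=> [lf _].
pose g : {linear X -> Y} := HB.pack f (GRing.isLinear.Build _ _ _ _ _ lf).
exact: (linearZ_LR g).
Qed.

Lemma bounded_linearB f x y : bounded_linear f -> f (x - y) = f x - f y.
Proof.
move=> [lf _].
pose g : {linear X -> Y} := HB.pack f (GRing.isLinear.Build _ _ _ _ _ lf).
exact: (linearB g).
Qed.

Lemma linear_bounded_linear f (M : R) :
  linear f -> (forall x, `|f x| <= M * `|x|) -> bounded_linear f.
Proof.
move=> lf fM; split=> //.
pose g : {linear X -> Y} := HB.pack f (GRing.isLinear.Build _ _ _ _ _ lf).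
apply: (@bounded_linear_continuous _ _ _ g).
apply/linear_boundedP.
near=> N => x; apply: (le_trans (fM x)).
by rewrite ler_wpM2r//; near: N; exact: nbhs_pinfty_ge.
Unshelve. all: by end_near. Qed.

Lemma bounded_linear_scaled_sub f g (c : R) :
  bounded_linear f -> bounded_linear g ->
  bounded_linear (fun x => c *: (f x - g x)).
Proof.
move=> [lf cf] [lg cg]; split.
  move=> a x y; rewrite lf lg opprD addrACA -scalerBr scalerDr !scalerA.
  by rewrite (mulrC c).
by move=> x; apply: cvgZ; [exact: cvg_cst|apply: cvgB; [exact: cf|exact: cg]].
Qed.

(** Each z is a multiple of a vector y - x with y in the ball around x. The
    norm bound depends on r and M only, so it is uniform over families. *)
Lemma bounded_linear_bound f (x : X) (r M : R) : bounded_linear f -> 0 < r ->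
  (forall y, ball x r y -> `|f y| <= M) ->
  forall z, `|f z| <= (4 * M / r) * `|z|.
Proof.
move=> lf r0 fM z.
have [->|z0] := eqVneq z 0.
  by rewrite -[X in f X](subrr 0) bounded_linearB// subrr !normr0 mulr0.
have nz : 0 < `|z| by rewrite normr_gt0.
(* [x + c *: z] is at distance r / 2 from x *)
pose c := r / 2 / `|z|.
have c0 : 0 < c by rewrite !divr_gt0.
have fcz : `|f (c *: z)| <= 2 * M.
  have -> : c *: z = (x + c *: z) - x by rewrite addrC addKr.
  rewrite bounded_linearB// mulrDl mul1r.
  apply: (le_trans (ler_normB _ _)); apply: lerD; apply: fM; last first.
    exact: ballxx.
  rewrite -ball_normE/= opprD addNKr normrN normrZ gtr0_norm//.
  by rewrite /c divfK ?gt_eqF//; lra.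
move: fcz; rewrite bounded_linearZ// normrZ gtr0_norm// -ler_pdivlMl//.
move=> /le_trans; apply; rewrite le_eqVlt; apply/orP; left; apply/eqP.
by rewrite /c; field; rewrite !gt_eqF.
Qed.

End BoundedLinear.

(** * Dense open sets *)

Section Baire.
Context (R : realType) (X : completeNormedModType R).

Lemma Baire_countable (I : countType) (O : I -> set X) :
  (forall i, open (O i) /\ dense (O i)) -> exists x, forall i, O i x.
Proof.
move=> odO.
pose F n := if @unpickle I n is Some i then O i else setT.
have odF n : open (F n) /\ dense (F n).
  rewrite /F; case: unpickle => [i|]; first exact: odO.
  by split; [exact: openT|move=> U U0 _; rewrite setIT].
have [|x [_ Fx]] := Baire odF (O := setT) _ openT; first by exists point.
by exists x => i; have := Fx (pickle i) Logic.I; rewrite /F pickleK.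
Qed.

End Baire.

(** If x lies in W, then the points x + c x0 with c nonzero do not, and they
    approach x as c tends to 0. *)
Lemma dense_setC_subspace (R : realType) (X : normedModType R) (W : set X)
    (x0 : X) : ~ W x0 ->
  (forall a x y, W x -> W y -> W (a *: x + y)) -> dense (~` W).
Proof.
move=> Wx0 Wlin U [x Ux] oU.
have [Wx|] := pselect (W x); last by exists x.
have cx : (fun c : R => x + c *: x0) @ 0 --> x.
  rewrite -[X in _ --> X]addr0 -(scale0r x0).
  by apply: cvgD; [exact: cvg_cst|apply: cvgZ; [exact: cvg_id|exact: cvg_cst]].
have Uc : \forall c \near 0^', U (x + c *: x0).
  by apply: nbhs_dnbhs; apply: cx; exact: open_nbhs_nbhs.
have [c [Ucx c0]] := filter_ex (filterI Uc (nbhs_dnbhs_neq (0 : R))).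
exists (x + c *: x0); split=> // Wc; apply: Wx0.
have Wcx0 : W (c *: x0) by rewrite -(addKr x (c *: x0)) -scaleN1r; exact: Wlin.
have -> : x0 = (c^-1 - 1) *: (c *: x0) + c *: x0.
  by rewrite scalerBl scale1r subrK scalerK.
exact: Wlin.
Qed.

(** * Pointwise limits of bounded linear maps *)

Section PointwiseLimit.
Context (R : realType) (X Y : completeNormedModType R).
Context (H : Type) (F : set_system H) {FF : ProperFilter F} (B : nat -> set H).
Context (FB : forall l, F (B l)).
Context (baseB : forall A, F A -> exists l, B l `<=` A).
Context (D : H -> X -> Y).
Context (blD : forall l h, B l h -> bounded_linear (D h)).

Definition equibounded (A : set H) : Prop :=
  exists M : R, forall h, A h -> forall x, `|D h x| <= M * `|x|.

Definition exceeds (A : set H) (m : nat) : set X :=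
  [set x | exists2 h, A h & m%:R < `|D h x|].

Lemma open_exceeds l m : open (exceeds (B l) m).
Proof.
have -> : exceeds (B l) m =
    \bigcup_(h in B l) ((fun x => `|D h x|) @^-1` [set y | m%:R < y]).
  by apply/seteqP; split=> x [h]; exists h.
apply: bigcup_open => h /blD[_ cD]; apply: open_comp; last exact: open_gt.
by move=> x _; apply: cvg_norm; exact: cD.
Qed.

(** On a ball where all D_h are bounded by m, they are bounded in operator norm
    by a common constant. *)
Lemma dense_exceeds l m : ~ equibounded (B l) -> dense (exceeds (B l) m).
Proof.
move=> nD; apply: contrapT => /denseNE[U [[x /open_nbhs_nbhs]]].
move=> /nbhs_ballP[r /= r0 rU] UD; apply: nD.
exists (4 * m%:R / r) => h Bh.
apply: (bounded_linear_bound (x := x) (blD Bh) r0) => y xy.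
rewrite leNgt; apply/negP => mD.
suff : (U `&` exceeds (B l) m) y by rewrite UD.
by split; [exact: rU|exists h].
Qed.

Lemma cvg_not_exceeds x : cvg (D h x @[h --> F]) ->
  exists l m, ~ exceeds (B l) m x.
Proof.
move=> cD; pose m := (Num.truncn `|lim (D h x @[h --> F])|).+1.
have mD : `|lim (D h x @[h --> F])| < m%:R by exact: truncnS_gt.
have [l lD] := baseB (@cvgr_norm_lt _ _ _ _ _ _ _ cD _ mD).
by exists l, m => -[h /lD]; rewrite ltNge => /negP Dm /ltW.
Qed.

Lemma cvg_pointwise_linear a x y p q :
  D h x @[h --> F] --> p -> D h y @[h --> F] --> q ->
  D h (a *: x + y) @[h --> F] --> a *: p + q.
Proof.
move=> Dp Dq.
have Dpq : (fun h => a *: D h x + D h y) @ F --> a *: p + q.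
  by apply: cvgD => //; apply: cvgZ => //; exact: cvg_cst.
apply/(cvg_trans _ Dpq)/near_eq_cvg.
by apply: filterS (FB 0) => h /blD[lD _]; rewrite lD.
Qed.

(** With a common bound M on the norms, D_h x stays within M |w - x| of D_h w,
    so it satisfies the Cauchy criterion when x is a limit of points w of
    convergence. *)
Lemma closed_cvg_equibounded l : equibounded (B l) ->
  closed [set x | cvg (D h x @[h --> F])].
Proof.
move=> [M DM] x clx; apply: cauchy_cvg; apply: cauchy_exP => e e0.
(* [`|M| + 1] in place of [M], to divide by a positive number *)
have M0 : 0 < 2 * (`|M| + 1) by rewrite mulr_gt0// ltr_wpDl.
have [|w [/= cw xw]] := clx (ball x (e / (2 * (`|M| + 1)))).
  by apply: nbhsx_ballx; rewrite divr_gt0.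
exists (lim (D h w @[h --> F])).
have e2 : 0 < e / 2 by rewrite divr_gt0.
have Dw : \forall h \near F, `|lim (D h' w @[h' --> F]) - D h w| < e / 2.
  by apply: cvgr_dist_lt e2; exact: cw.
apply: filterS2 Dw (FB l) => h {}Dw Bh.
rewrite -ball_normE/= -(subrK (D h w) (lim _)) -addrA.
rewrite -(bounded_linearB _ _ (blD Bh)).
apply: (le_lt_trans (ler_normD _ _)); rewrite [ltRHS](splitr e).
apply: ltr_leD => //; apply: (le_trans (DM _ Bh _)).
move: xw; rewrite -ball_normE/= distrC ltr_pdivlMr// => xw.
have : M * `|w - x| <= (`|M| + 1) * `|w - x|.
  by rewrite ler_wpM2r// (le_trans (ler_norm _))// lerDl.
by lra.
Qed.

(** The set of points of convergence is either everything or meagre, although it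
    need not be closed. In the equibounded case all the V i coincide; otherwise
    V (l, m) makes D exceed m on the l-th basic set. *)
Lemma not_cvg_comeagre : (exists x, ~ cvg (D h x @[h --> F])) ->
  exists V : nat * nat -> set X, (forall i, open (V i) /\ dense (V i)) /\
    forall x, (forall i, V i x) -> ~ cvg (D h x @[h --> F]).
Proof.
move=> [x0 nx0]; have [[l eB]|nB] := pselect (exists l, equibounded (B l)).
  exists (fun=> ~` [set x | cvg (D h x @[h --> F])]); split; last first.
    by move=> x /(_ (0, 0)%N).
  move=> _; split; first by rewrite openC; exact: closed_cvg_equibounded eB.
  apply: (dense_setC_subspace nx0) => a x y cx cy.
  by apply/cvg_ex; eexists; exact: cvg_pointwise_linear cx cy.
exists (fun lm => exceeds (B lm.1) lm.2); split.
  move=> [l m]; split; first exact: open_exceeds.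
  by apply: dense_exceeds => eB; apply: nB; exists l.
by move=> x Ox /cvg_not_exceeds[l [m]]; apply; exact: (Ox (l, m)).
Qed.

(** A form of the uniform boundedness principle for a filter in place of a
    sequence: a family converging along F is bounded only near F, so the bound
    concerns one of the basic sets. *)
Lemma pointwise_cvg_equibounded : (forall x, cvg (D h x @[h --> F])) ->
  exists l, equibounded (B l).
Proof.
move=> cD; apply: contrapT => nB.
have [|x Ox] := @Baire_countable R X _ (fun lm => exceeds (B lm.1) lm.2).
  move=> [l m]; split; first exact: open_exceeds.
  by apply: dense_exceeds => eB; apply: nB; exists l.
by have [l [m]] := cvg_not_exceeds (cD x); apply; exact: (Ox (l, m)).
Qed.

Lemma bounded_linear_lim : (forall x, cvg (D h x @[h --> F])) ->
  bounded_linear (fun x => lim (D h x @[h --> F])).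
Proof.
move=> cD; have [l [M DM]] := pointwise_cvg_equibounded cD.
apply: (@linear_bounded_linear _ _ _ _ M).
  move=> a x y; apply: cvg_lim => //.
  by apply: cvg_pointwise_linear; exact: cD.
move=> x; rewrite -lim_norm//; apply: limr_le; first exact: is_cvg_norm.
by apply: filterS (FB l) => h Bh; exact: DM.
Qed.

End PointwiseLimit.

(** * A common threshold in the real case *)

Section EventuallyDifferentiable.
Context (R : realType) (X Y : completeNormedModType R).
Implicit Type v : X -> R -> Y.

(** These sets form a base of the punctured neighbourhoods of 0; the bound by d
    keeps h + s in the range of times where v is bounded linear. *)
Let punctured_ball (d : R) (l : nat) : set R :=
  [set h | h != 0 /\ `|h| < Num.min d l.+1%:R^-1].

Lemma punctured_ball_dnbhs d :
  0 < d -> forall l, (0 : R)^' (punctured_ball d l).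
Proof.
move=> d0 l; near=> h; split; near: h; first exact: nbhs_dnbhs_neq.
by apply: dnbhs0_lt; rewrite lt_min d0 invr_gt0 ltr0n.
Unshelve. all: by end_near. Qed.

Lemma punctured_ball_base d (A : set R) : (0 : R)^' A ->
  exists l, punctured_ball d l `<=` A.
Proof.
move=> /nbhs_ballP[e /= e0 eA]; exists (Num.truncn e^-1).
move=> h [h0 hl]; apply: eA => //; rewrite -ball_normE/= sub0r normrN.
move: hl; rewrite lt_min => /andP[_ hl]; apply: (lt_trans hl).
by rewrite invf_plt ?posrE// truncnS_gt.
Qed.

Lemma bounded_linear_diff_quotient v t s h :
  (forall r, t < r -> bounded_linear (v^~ r)) -> t < s -> `|h| < s - t ->
  bounded_linear (fun x => diff_quotient idfun (v x) s h).
Proof.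
move=> blv ts hs; apply: bounded_linear_scaled_sub; apply: blv => //.
by move: hs; rewrite ltr_norml; lra.
Qed.

Lemma bounded_linear_rderive v t s :
  (forall r, t < r -> bounded_linear (v^~ r)) -> t < s ->
  (forall x, rderivable idfun (v x) s) ->
  bounded_linear (fun x => rderive idfun (v x) s).
Proof.
move=> blv ts dv; have st : 0 < s - t by rewrite subr_gt0.
apply: (bounded_linear_lim (D := fun h x => diff_quotient idfun (v x) s h)
  (punctured_ball_dnbhs st) (@punctured_ball_base (s - t))) => //.
move=> l h [_]; rewrite lt_min => /andP[hst _].
exact: bounded_linear_diff_quotient blv ts hst.
Qed.

(** Points of non-differentiability beyond every t0 + n give countably many
    proper subspaces, and the Baire category theorem yields an orbit that is
    differentiable at none of the chosen points. *)
Lemma rderivable_uniform v t0 :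
  (forall r, t0 < r -> bounded_linear (v^~ r)) ->
  (forall x, exists tx, forall s, tx < s -> rderivable idfun (v x) s) ->
  exists2 t, t0 <= t & forall x s, t < s -> rderivable idfun (v x) s.
Proof.
move=> blv dv; apply: contrapT => nt.
have bad n : exists s, t0 + n%:R < s /\ exists x, ~ rderivable idfun (v x) s.
  apply: contrapT => ns; apply: nt; exists (t0 + n%:R); first by rewrite lerDl.
  move=> x s ts; apply: contrapT => nd; apply: ns.
  by exists s; split => //; exists x.
have [s_ sP] := choice bad.
have /choice[V VP] : forall n, exists W : nat * nat -> set X,
    (forall i, open (W i) /\ dense (W i)) /\
    forall x, (forall i, W i x) -> ~ rderivable idfun (v x) (s_ n).
  move=> n; have [ts xn] := sP n.
  have ts0 : t0 < s_ n by rewrite (le_lt_trans _ ts)// lerDl.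
  have st : 0 < s_ n - t0 by rewrite subr_gt0.
  apply: (not_cvg_comeagre
    (D := fun h x => diff_quotient idfun (v x) (s_ n) h)
    (punctured_ball_dnbhs st) (@punctured_ball_base (s_ n - t0))) => //.
  move=> l h [_]; rewrite lt_min => /andP[hst _].
  exact: bounded_linear_diff_quotient blv ts0 hst.
have [|x Ox] := @Baire_countable R X _ (fun i : nat * (nat * nat) => V i.1 i.2).
  by move=> [n i]; exact: (VP n).1.
have [tx dx] := dv x.
pose n := (Num.truncn `|tx - t0|).+1.
have : t0 + n%:R < s_ n := (sP n).1.
have : `|tx - t0| < n%:R by exact: truncnS_gt.
rewrite ltr_norml => /andP[_ txn] ts.
apply: ((VP n).2 x); first by move=> i; exact: (Ox (n, i)).
by apply: dx; lra.
Qed.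

(** The induction step passes from v to its derivative, which is bounded linear
    in x only beyond the threshold t1 of the first derivative; hence the
    variable lower bound t0. *)
Lemma times_differentiable_uniform k v t0 :
  (forall r, t0 < r -> bounded_linear (v^~ r)) ->
  (forall x, exists tx,
    times_differentiable_on idfun k (v x) [set s | tx < s]) ->
  exists2 t, t0 <= t &
    forall x, times_differentiable_on idfun k (v x) [set s | t < s].
Proof.
elim: k v t0 => [|k IH] v t0 blv dv; first by exists t0.
have [|t1 t01 d1] := rderivable_uniform blv.
  by move=> x; have [tx dx] := dv x; exists tx => s; exact: (dx 0).
have [||t t1t dt] := IH (fun x => rderive idfun (v x)) t1.
- move=> r tr; apply: (bounded_linear_rderive blv); first exact: le_lt_trans tr.
  by move=> x; exact: d1.
- move=> x; have [tx dx] := dv x; exists tx => j jk s ts.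
  by rewrite /rderiven -iterSr; exact: (dx j.+1).
exists t; first exact: le_trans t1t.
move=> x [|j] jk s ts; first by apply: d1; exact: le_lt_trans ts.
by rewrite /rderiven iterSr; exact: dt.
Qed.

Lemma orbit_times_differentiable_uniform k (u : {nonneg R} -> bounded_op X Y) :
  (forall x : X, exists tx : R, 0 <= tx /\
     times_differentiable_on idfun k (orbit_fun u x) [set s | tx < s]) ->
  exists t : R, 0 <= t /\ forall x : X,
     times_differentiable_on idfun k (orbit_fun u x) [set s | t < s].
Proof.
move=> da; have [||t t0 dt] := @times_differentiable_uniform k (orbit_fun u) 0.
- move=> r _; rewrite /orbit_fun; case: (u _) => f [M fM] /=.
  by apply: (linear_bounded_linear _ fM); exact: linearP.
- by move=> x; have [tx [_ dx]] := da x; exists tx.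
by exists t.
Qed.

End EventuallyDifferentiable.

(** * Restriction of scalars from the complex to the real numbers *)

Section Realify.
Context (R : realType).
Local Notation C := (complex R).
Local Notation iota := (real_complex R).

(** An alias, so that the real structures do not clash with the complex ones.
    The group, the uniform structure and the base point are those of X: limits,
    and the default value of a limit that does not exist, are the same in both
    spaces by conversion. *)
Definition realify (X : normedModType C) : Type := X.

Section Instances.
Context (X : normedModType C).

HB.instance Definition _ := GRing.Zmodule.copy (realify X) X.
HB.instance Definition _ := Uniform.copy (realify X) X.
HB.instance Definition _ := isPointed.Build (realify X) (point : X).

Definition realify_scale (a : R) (x : realify X) : realify X :=
  iota a *: (x : X).

Fact realify_scaleA a b x :
  realify_scale a (realify_scale b x) = realify_scale (a * b) x.
Proof. by rewrite /realify_scale scalerA rmorphM. Qed.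

Fact realify_scale1 : left_id 1 realify_scale.
Proof. by move=> x; rewrite /realify_scale rmorph1 scale1r. Qed.

Fact realify_scaleDr : right_distributive realify_scale +%R.
Proof. by move=> a x y; rewrite /realify_scale scalerDr. Qed.

Fact realify_scaleDl x : {morph realify_scale^~ x : a b / a + b}.
Proof. by move=> a b; rewrite /realify_scale rmorphD scalerDl. Qed.

HB.instance Definition _ := GRing.Zmodule_isLmodule.Build R (realify X)
  realify_scaleA realify_scale1 realify_scaleDr realify_scaleDl.

(** The complex norm takes values in R[i], where it is a real number. *)
Definition realify_norm (x : realify X) : R := complex.Re `|x : X|.

Lemma realify_normE (x : X) : iota (realify_norm x) = `|x|.
Proof. by apply: RRe_real; exact: normr_real. Qed.

Fact realify_normD x y :
  realify_norm (x + y) <= realify_norm x + realify_norm y.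
Proof.
by rewrite -lecR rmorphD/= !realify_normE; exact: ler_normD.
Qed.

Fact realify_norm_eq0 x : realify_norm x = 0 -> x = 0.
Proof.
move=> x0; have := realify_normE x; rewrite x0 rmorph0 => /esym/eqP.
by rewrite normr_eq0 => /eqP.
Qed.

Fact realify_normMn x n : realify_norm (x *+ n) = realify_norm x *+ n.
Proof.
by apply: (fmorph_inj iota); rewrite rmorphMn/= !realify_normE normrMn.
Qed.

Fact realify_normN x : realify_norm (- x) = realify_norm x.
Proof. by rewrite /realify_norm normrN. Qed.

HB.instance Definition _ := Num.Zmodule_isNormed.Build R (realify X)
  realify_normD realify_norm_eq0 realify_normMn realify_normN.

Let rball := ball_ (fun x : realify X => `|x|).

Fact realify_ball_center x (e : R) : 0 < e -> rball x e x.
Proof. by move=> e0; rewrite /rball /ball_/= subrr normr0. Qed.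

Fact realify_ball_sym x y (e : R) : rball x e y -> rball y e x.
Proof. by rewrite /rball /ball_/= distrC. Qed.

Fact realify_ball_triangle x y z (e1 e2 : R) :
  rball x e1 y -> rball y e2 z -> rball x (e1 + e2) z.
Proof. exact: ball_norm_triangle. Qed.

Lemma realify_ballE (x : X) (e : R) : rball x e = ball x (iota e).
Proof.
by apply/seteqP; rewrite -ball_normE; split=> y /=;
  rewrite /rball /ball_/= -ltcR realify_normE.
Qed.

(** Every positive radius in R[i] is real, so the real balls generate the
    uniform structure that X already has. *)
Fact realify_entourageE : entourage = entourage_ rball.
Proof.
transitivity (@entourage_ C X X ball); first by rewrite entourageE_subproof.
apply/seteqP; split=> A [e /= e0 eA].
- have /complex_realP[r er] : e \is Num.real by exact: gtr0_real.
  exists r => /=; first by rewrite -ltcR -er.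
  by move=> xy rxy; apply: eA => /=; rewrite er -realify_ballE.
- exists (iota e); first by rewrite /= ltcR.
  by move=> xy rxy; apply: eA; rewrite /= realify_ballE.
Qed.

HB.instance Definition _ := Uniform_isPseudoMetric.Build R (realify X)
  realify_ball_center realify_ball_sym realify_ball_triangle realify_entourageE.

HB.instance Definition _ :=
  NormedZmod_PseudoMetric_eq.Build R (realify X) erefl.

Fact realify_normZ (a : R) (x : realify X) : `|a *: x| = `|a| * `|x|.
Proof.
apply: (fmorph_inj iota); rewrite rmorphM/= !realify_normE.
by rewrite [LHS]normrZ normc_def/= expr0n addr0 sqrtr_sqr.
Qed.

HB.instance Definition _ :=
  PseudoMetricNormedZmod_Lmodule_isNormedModule.Build R (realify X)
    realify_normZ.

End Instances.

HB.instance Definition _ (X : completeNormedModType C) :=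
  Uniform_isComplete.Build (realify X) (@cauchy_cvg X).

Lemma diff_quotient_realify (Y : normedModType C) (g : R -> Y) s :
  diff_quotient iota g s = diff_quotient idfun (g : R -> realify Y) s.
Proof. by apply/funext => h; rewrite /diff_quotient -fmorphV. Qed.

Lemma rderive_realify (Y : normedModType C) (g : R -> Y) :
  rderive iota g = rderive idfun (g : R -> realify Y).
Proof. by apply/funext => s; rewrite /rderive diff_quotient_realify. Qed.

Lemma times_differentiable_on_realify (Y : normedModType C) k (f : R -> Y) D :
  times_differentiable_on iota k f D <->
  times_differentiable_on idfun k (f : R -> realify Y) D.
Proof.
have rdnE j : rderiven iota j f = rderiven idfun j (f : R -> realify Y).
  elim: j => [|j IH]; first by [].
  change (rderive iota (rderiven iota j f) =
    rderive idfun (rderiven idfun j (f : R -> realify Y))).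
  by rewrite IH rderive_realify.
by split=> df j jk s Ds; have := df j jk s Ds;
  rewrite /rderivable rdnE diff_quotient_realify.
Qed.

Lemma realify_bounded_op (X Y : normedModType C) (f : bounded_op X Y) :
  exists g : bounded_op (realify X) (realify Y), sval g = sval f :> (X -> Y).
Proof.
case: f => f [M fM].
have lf : linear (f : realify X -> realify Y).
  by move=> a x y; exact: (linearP f).
pose g : {linear realify X -> realify Y} :=
  HB.pack (f : realify X -> realify Y) (GRing.isLinear.Build _ _ _ _ _ lf).
suff gM : exists N : R, forall x, `|g x| <= N * `|x|.
  by exists (exist _ g gM).
have /complex_realP[N MN] : `|M| \is Num.real by exact: normr_real.
exists N => x; rewrite -lecR rmorphM/= !realify_normE.
have -> : iota N = `|M| by [].
(* [M] is a complex scalar, but [M * `|x|] is at least [`|f x|], hence real *)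
rewrite -[X in _ <= _ * X]normr_id -normrM.
by rewrite ger0_norm ?fM// (le_trans _ (fM x)).
Qed.

Lemma orbit_times_differentiable_uniform_complex (X Y : completeNormedModType C)
    k (u : {nonneg R} -> bounded_op X Y) :
  (forall x : X, exists tx : R, 0 <= tx /\
     times_differentiable_on iota k (orbit_fun u x) [set s | tx < s]) ->
  exists t : R, 0 <= t /\ forall x : X,
     times_differentiable_on iota k (orbit_fun u x) [set s | t < s].
Proof.
move=> da; have [v vu] := choice (fun r => realify_bounded_op (u r)).
have uv x : orbit_fun u x = orbit_fun v x :> (R -> Y).
  by apply/funext => s; rewrite /orbit_fun vu.
have duv x t :
    times_differentiable_on iota k (orbit_fun u x) [set s | t < s] <->
    times_differentiable_on idfun k (orbit_fun v x) [set s | t < s].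
  rewrite -(uv x).
  exact: times_differentiable_on_realify.
have [|t [t0 dt]] := @orbit_times_differentiable_uniform R _ _ k v.
  move=> x; have [tx [tx0 dx]] := da x.
  by exists tx; split; [exact: tx0|exact: (iffLR (duv x tx) dx)].
exists t; split; first exact: t0.
by move=> x; exact: (iffRL (duv x t) (dt x)).
Qed.

End Realify.

(** * The equivalence over the real and the complex numbers *)

Theorem corollary3p15 (R : realType) (k : nat) (hk : (0 < k)%N) :
  (forall (X Y : completeNormedModType R) (u : {nonneg R} -> bounded_op X Y),
     (forall x : X, exists tx : R, 0 <= tx /\
        times_differentiable_on idfun k (orbit_fun u x) [set s | tx < s])
     <->
     (exists t : R, 0 <= t /\ forall x : X,
        times_differentiable_on idfun k (orbit_fun u x) [set s | t < s]))
  /\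
  (forall (X Y : completeNormedModType (complex R))
          (u : {nonneg R} -> bounded_op X Y),
     (forall x : X, exists tx : R, 0 <= tx /\
        times_differentiable_on (real_complex R) k (orbit_fun u x)
          [set s | tx < s])
     <->
     (exists t : R, 0 <= t /\ forall x : X,
        times_differentiable_on (real_complex R) k (orbit_fun u x)
          [set s | t < s])).
Proof.
split=> X Y u; split=> [|[t [t0 dt]] x].
- exact: orbit_times_differentiable_uniform.
- by exists t; split; [exact: t0|exact: dt].
- exact: orbit_times_differentiable_uniform_complex.
- by exists t; split; [exact: t0|exact: dt].
Qed.
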